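(* Let $a_0,a_1,b_0,b_1$ be real numbers such that $a(N):=a_1N+a_0>0$ and $b(N):=b_1N+b_0>0$ for every positive integer $N$. For every integer $k\geq 1$, let $I_k(N)$ denote the quantity $I_k$ (defined in the context) computed with $N$ variables and parameters $a=a(N)$, $b=b(N)$. Then $\lim_{N\to\infty}\frac{I_k(N)}{N}$ exists and is finite.
   Context: For a positive integer $N$, real numbers $a,b>0$ and a function $f$ of $N$ variables, set $\langle f\rangle_{a,b}=\frac1{N!}\int_{[0,1]^N}f(x_1,\dots,x_N)\prod_{1\le i<j\le N}(x_i-x_j)^2\prod_{i=1}^Nx_i^{a-1}(1-x_i)^{b-1}\,dx_i$. Let $p_k(x_1,\dots,x_N)=\sum_{i=1}^N x_i^k$ be the $k$-th power sum and $I_k:=\langle p_k\rangle_{a,b}/\langle 1\rangle_{a,b}$. *)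

(* Defs.v *)
From HB Require Import structures.
From mathcomp Require Import all_boot all_order all_algebra.
From mathcomp Require Import all_classical all_reals all_analysis.
Set Implicit Arguments. Unset Strict Implicit. Unset Printing Implicit Defensive.
Import Order.TTheory GRing.Theory Num.Theory.
Local Open Scope classical_set_scope.
Local Open Scope ring_scope.

Section Jacobi.
Variable R : realType.

Definition vcons (x : R) (v : nat -> R) : nat -> R :=
  fun i => if i is i'.+1 then v i' else x.

(* Iterated Lebesgue integral over [0,1]^n of F, where F depends on the
   coordinates v 0, ..., v (n-1):
   iint n F = \int_0^1 ... \int_0^1 F(x_1,...,x_n) dx_n ... dx_1 *)
Fixpoint iint (n : nat) (F : (nat -> R) -> R) : R :=
  match n with
  | 0 => F (fun _ => 0)
  | n'.+1 => Rintegral (@lebesgue_measure R) `[0%R, 1%R]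
               (fun x => iint n' (fun v => F (vcons x v)))
  end.

Definition jacobi_weight (N : nat) (a b : R) (v : nat -> R) : R :=
  (\prod_(0 <= i < N) \prod_(i.+1 <= j < N) (v i - v j) ^+ 2) *
  \prod_(0 <= i < N) ((v i) `^ (a - 1) * (1 - v i) `^ (b - 1)).

Definition jacobi_avg (N : nat) (a b : R) (f : (nat -> R) -> R) : R :=
  (N`!%:R)^-1 * iint N (fun v => f v * jacobi_weight N a b v).

Definition power_sum (N k : nat) (v : nat -> R) : R := \sum_(0 <= i < N) v i ^+ k.

Definition Ik (N k : nat) (a b : R) : R :=
  jacobi_avg N a b (power_sum N k) / jacobi_avg N a b (fun _ => 1).

End Jacobi.

(* Main.v *)
(* The quotient I_k is a ratio of Hankel determinants in the beta moments
   m n = \int_0^1 x^(a+n-1) (1-x)^(b-1) dx: by Andreief's identity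
     I_k = \sum_r det (m (i + j), row r shifted by k) / det (m (i + j)).
   Since m (n+1) / m n = (a+n) / (a+b+n), the number m (n + j) is, up to a factor
   depending on n only, the value at n of a polynomial of degree N-1, so Lagrange
   interpolation expands a shifted row in the unshifted ones.  Rows shifted inside the
   matrix contribute 0, and only the last k rows remain, each contributing an
   explicit product whose number of factors does not depend on N.  Hence I_k(N)/N is
   a rational function of N for N >= k.  It lies in [0, 1] because 0 <= x^k <= 1, and
   a bounded rational function has a finite limit at infinity, so that no
   cancellation between the k terms has to be analysed. *)
Require Import Defs.
From HB Require Import structures.
From mathcomp Require Import all_boot all_order all_algebra.
From mathcomp Require Import all_classical all_reals all_analysis.
From mathcomp Require Import perm measurable_realfun qpoly ring lra.
Import Order.TTheory GRing.Theory Num.Theory numFieldNormedType.Exports.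
Local Open Scope classical_set_scope.
Local Open Scope ring_scope.
Set Implicit Arguments. Unset Strict Implicit. Unset Printing Implicit Defensive.

(** * Improper integrals and beta integrals *)

Section FTC_oo.
Context {R : realType}.
Notation mu := (@lebesgue_measure R).

(** The endpoints may be singular, so the interval is exhausted by compact subintervals: the usual
    fundamental theorem applies on each of them, and nonnegativity of [f] allows monotone
    convergence. *)
Lemma ge0_continuous_FTC2_oo (f F : R -> R) (a b la lb : R) : a < b ->
  {in `]a, b[, continuous f} -> {in `]a, b[, forall x, 0 <= f x} ->
  (forall x, x \in `]a, b[ -> is_derive x 1 F (f x)) ->
  F x @[x --> a^'+] --> la -> F x @[x --> b^'-] --> lb ->
  (\int[mu]_(x in `]a, b[) (f x)%:E = (lb - la)%:E)%E.
Proof.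
move=> ab cf f0 dF Fa Fb.
(* The offset 3 gives [e n <= (b - a) / 3], so that [a + e n < b - e n] holds from [n = 0] on. *)
pose e (n : nat) : R := (b - a) * (n%:R + 3)^-1.
pose D n : set R := `[a + e n, b - e n]%classic.
have e0 n : 0 < e n by rewrite mulr_gt0 ?subr_gt0// invr_gt0 ltr_wpDl.
have eab n : a + e n < b - e n.
  have : (n%:R + 3)^-1 <= 3^-1 :> R by rewrite lef_pV2 ?posrE ?lerDr// ltr_wpDl.
  move=> /(ler_wpM2l (ltW (_ : 0 < b - a))); rewrite subr_gt0 -/(e n) => /(_ ab).
  lra.
have eD n x : x \in `[a + e n, b - e n] -> x \in `]a, b[.
  by rewrite !in_itv/= => /andP[? ?]; have := e0 n; lra.
have ecvg : e @ \oo --> 0.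
  rewrite -(mulr0 (b - a)); apply: cvgMr.
  apply/gtr0_cvgV0; first by near=> n; rewrite ltr_wpDl.
  apply/cvgryPge => A; near=> n.
  by rewrite ler_wpDr//; near: n; exact: nbhs_infty_ger.
have dFn n : (\int[mu]_(x in D n) (f x)%:E = (F (b - e n))%:E - (F (a + e n))%:E)%E.
  have cF x : x \in `[a + e n, b - e n] -> {for x, continuous F}.
    by move=> /eD/dF dFx; apply/differentiable_continuous/derivable1_diffP/ex_derive.
  have ein c : c \in `[a + e n, b - e n] -> [/\ F x @[x --> c^'+] --> F c &
     F x @[x --> c^'-] --> F c].
    by move=> /cF cc; split; [exact: cvg_at_right_filter|exact: cvg_at_left_filter].
  have inoo x : x \in `]a + e n, b - e n[ -> x \in `[a + e n, b - e n].
    by move/subset_itv_oo_cc.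
  apply: continuous_FTC2 => //.
  - apply: continuous_in_subspaceT => x; rewrite inE/= => /eD; exact: cf.
  - split.
    + by move=> x /inoo/eD/dF dFx; exact: ex_derive.
    + by case: (ein (a + e n)) => //; rewrite in_itv/= lexx ltW.
    + by case: (ein (b - e n)) => //; rewrite in_itv/= lexx ltW.
  - by move=> x /inoo/eD/dF dFx; rewrite derive1E derive_val.
have DU : \bigcup_n D n = `]a, b[%classic.
  apply/seteqP; split => [x [n _]/= /eD//|x/=]; rewrite in_itv/= => /andP[ax xb].
  pose d := Num.min (x - a) (b - x).
  have d0 : 0 < d by rewrite lt_min !subr_gt0 ax xb.
  have [n _ /(_ n (leqnn n))/= ed] : \forall n \near \oo, e n < d.
    exact: (@cvgr_lt _ _ _ _ _ _ ecvg).
  exists n => //; rewrite /D/= in_itv/=; move: ed; rewrite lt_min => /andP[? ?].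
  by apply/andP; split; lra.
rewrite -DU.
have mf n : measurable_fun (D n) f.
  apply: (@measurable_funS _ _ _ _ `]a, b[%classic) => //.
    by move=> x /eD.
  by apply: open_continuous_measurable_fun => // x; rewrite inE; exact: cf.
have cvgD : (\int[mu]_(x in D n) (f x)%:E)%E @[n --> \oo] -->
    (\int[mu]_(x in \bigcup_n D n) (f x)%:E)%E.
  apply: ge0_nondecreasing_set_cvg_integral.
  - move=> m n mn; rewrite subsetEset => x; rewrite /D/= !in_itv/= => /andP[? ?].
    have : e n <= e m.
      by rewrite ler_pM2l ?subr_gt0// lef_pV2 ?posrE ?ltr_wpDl// lerD2r ler_nat.
    move=> ?; have -> : a + e n <= x by lra.
    by have -> : x <= b - e n by lra.
  - by move=> n; exact: measurable_itv.
  - by move=> n; apply/measurable_EFinP; exact: mf.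
  - by move=> n x /eD/f0; rewrite lee_fin.
apply: cvg_unique cvgD _ => //.
rewrite (_ : (fun n => _) = (fun n => (F (b - e n) - F (a + e n))%:E)); last first.
  by apply/funext => n; rewrite dFn EFinB.
apply: cvg_EFin; first exact: nearW.
apply: cvgB.
- apply: (cvg_at_leftP F b lb).1 => //; split.
    by move=> n; rewrite ltrBlDr ltrDl.
  by rewrite -[X in _ --> X]subr0; apply: cvgB => //; exact: cvg_cst.
- apply: (cvg_at_rightP F a la).1 => //; split.
    by move=> n; rewrite ltrDl.
  by rewrite -[X in _ --> X]addr0; apply: cvgD => //; exact: cvg_cst.
Unshelve. all: by end_near. Qed.

End FTC_oo.

(** * Integrability, recurrence and positivity of the beta integral *)

Section beta_integral.
Context {R : realType}.
Notation mu := (@lebesgue_measure R).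
Implicit Types a b x : R.

Definition beta_kernel a b x : R := x `^ (a - 1) * (1 - x) `^ (b - 1).

Definition beta_integral a b : R := \int[mu]_(x in `[0, 1]) beta_kernel a b x.

Lemma beta_kernel_ge0 a b x : 0 <= beta_kernel a b x.
Proof. by rewrite mulr_ge0 ?powR_ge0. Qed.

Lemma measurable_beta_kernel a b : measurable_fun [set: R] (beta_kernel a b).
Proof.
apply: measurable_funM; first exact: measurable_powR.
apply: (@measurableT_comp _ _ _ _ _ _ (@powR R ^~ (b - 1))).
  exact: measurable_powR.
exact: measurable_funB.
Qed.

(** For positive [a] and [b] it vanishes at both endpoints, and its derivative combines the kernels
    with parameters [a] and [a + 1]: this is the integration by parts behind the recurrence. *)
Let primitive a b x : R := x `^ a * (1 - x) `^ b.

Let itv01 x : x \in `]0, 1[ -> 0 < x /\ 0 < 1 - x.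
Proof. by rewrite in_itv/= subr_gt0 => /andP. Qed.

Let is_derive_onem_powR b x : 0 < 1 - x ->
  is_derive x 1 (fun y : R => (1 - y) `^ b) (- (b * (1 - x) `^ (b - 1))).
Proof.
move=> x1; have dx := is_derive1_powR b x1.
have dB : is_derive x 1 (fun y : R => 1 - y) (-1).
  by apply: is_derive_eq; rewrite add0r mul1r.
have H := is_derive1_comp (f := @powR R ^~ b) (g := fun y : R => 1 - y) dx dB.
by rewrite mulrN1 in H; exact: H.
Qed.

Let powR_continuous a x : 0 < x -> {for x, continuous (@powR R ^~ a)}.
Proof.
move=> x0; apply/differentiable_continuous/derivable1_diffP.
by apply: ex_derive; exact: is_derive1_powR.
Qed.

Let onem_powR_continuous b x : 0 < 1 - x ->
  {for x, continuous (fun y : R => (1 - y) `^ b)}.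
Proof.
move=> x0; apply/differentiable_continuous/derivable1_diffP.
by apply: ex_derive; exact: is_derive_onem_powR.
Qed.

Lemma beta_kernel_continuous a b x : x \in `]0, 1[ ->
  {for x, continuous (beta_kernel a b)}.
Proof.
by case/itv01 => x0 x1; apply: cvgM; [exact: powR_continuous|
  exact: onem_powR_continuous].
Qed.

Let is_derive_primitive a b x : x \in `]0, 1[ ->
  is_derive x 1 (primitive a b) (beta_kernel a b x * (a - (a + b) * x)).
Proof.
move=> /itv01[x0 x1].
have dx := is_derive1_powR a x0.
have dy := is_derive_onem_powR b x1.
apply: is_derive_eq; rewrite /beta_kernel /= /GRing.scale/=.
have e (c y : R) : 0 < y -> y `^ c = y * y `^ (c - 1).
  move=> y0; have y1 : y != 0 by rewrite gt_eqF.
  have y2 : 0 <= y by exact: ltW.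
  rewrite powRB; last by rewrite y1 implybT.
  by rewrite (powRr1 y2) mulrCA divff// mulr1.
by rewrite (e a x)// (e b (1 - x))//; ring.
Qed.

Let primitive_cvg0 a b : 0 < a -> primitive a b x @[x --> 0^'+] --> 0.
Proof.
move=> a0; rewrite -[X in _ --> X](mul0r ((1 - 0) `^ b)); apply: cvgM; first exact: powR_cvg0.
by apply: cvg_at_right_filter; apply: onem_powR_continuous; rewrite subr0.
Qed.

Let primitive_cvg1 a b : 0 < b -> primitive a b x @[x --> 1^'-] --> 0.
Proof.
move=> b0; rewrite -[X in _ --> X](mulr0 (1 `^ a)); apply: cvgM.
  by apply: cvg_at_left_filter; exact: powR_continuous.
(* If a sequence tends to 1 from the left, then 1 minus it tends to 0 from the right, where
   [powR_cvg0] applies. *)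
apply/cvg_at_leftP => u [u1 ucvg].
apply: (cvg_at_rightP (@powR R ^~ b) 0 0).1; first exact: powR_cvg0.
split=> [n|]; first by rewrite subr_gt0.
by rewrite -(subrr 1); apply: cvgB => //; exact: cvg_cst.
Qed.

Lemma integrable_itvoo_cc (f : R -> R) (x y : R) : measurable_fun [set: R] f ->
  mu.-integrable `]x, y[ (EFin \o f) -> mu.-integrable `[x, y] (EFin \o f).
Proof.
move=> mf /integrableP[_ foo]; apply/integrableP; split.
  by apply: measurable_funTS; exact/measurable_EFinP.
rewrite integral_itv_bndoo//; apply: measurable_funTS.
by apply: measurableT_comp => //; exact/measurable_EFinP.
Qed.

Let ge0_integrable_oo (f F : R -> R) (l0 l1 : R) :
  measurable_fun [set: R] f ->
  {in `]0, 1[, continuous f} -> {in `]0, 1[, forall x, 0 <= f x} ->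
  (forall x, x \in `]0, 1[ -> is_derive x 1 F (f x)) ->
  F x @[x --> 0^'+] --> l0 -> F x @[x --> 1^'-] --> l1 ->
  mu.-integrable `]0, 1[ (EFin \o f).
Proof.
move=> mf cf f0 dF F0 F1; apply/integrableP; split.
  by apply: measurable_funTS; exact/measurable_EFinP.
have -> : (\int[mu]_(x in `]0%R, 1%R[) `|(EFin \o f) x| =
    \int[mu]_(x in `]0%R, 1%R[) (f x)%:E)%E.
  by apply: eq_integral => x; rewrite inE/= => x01; rewrite ger0_norm// f0.
by rewrite (ge0_continuous_FTC2_oo ltr01 cf f0 dF F0 F1) ltry.
Qed.

(** The kernel may be singular at both ends. It is dominated by the sum of the kernels with
    parameters (a, 1) and (1, b), which have one possible singularity each and an elementary
    primitive. *)
Lemma integrable_beta_kernel a b : 0 < a -> 0 < b ->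
  mu.-integrable `[0, 1] (EFin \o beta_kernel a b).
Proof.
move=> a0 b0; apply: integrable_itvoo_cc; first exact: measurable_beta_kernel.
have k1 c x : beta_kernel c 1 x = x `^ (c - 1).
  by rewrite /beta_kernel subrr powRr0 mulr1.
have k1' c x : beta_kernel 1 c x = (1 - x) `^ (c - 1).
  by rewrite /beta_kernel subrr powRr0 mul1r.
have ia : mu.-integrable `]0, 1[ (EFin \o beta_kernel a 1).
  apply: (@ge0_integrable_oo _ (fun x => a^-1 * x `^ a) (a^-1 * 0) (a^-1 * 1 `^ a)).
  - exact: measurable_beta_kernel.
  - by move=> x; exact: beta_kernel_continuous.
  - by move=> x _; exact: beta_kernel_ge0.
  - move=> x /itv01[x0 _]; have dx := is_derive1_powR a x0.
    rewrite (_ : beta_kernel a 1 x = a^-1 *: (a * x `^ (a - 1))).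
      exact: is_deriveZ.
    by rewrite k1 /GRing.scale/= mulKf// gt_eqF.
  - by apply: cvgMr; exact: powR_cvg0.
  - by apply: cvgMr; apply: cvg_at_left_filter; exact: powR_continuous.
have ib : mu.-integrable `]0, 1[ (EFin \o beta_kernel 1 b).
  (* With first parameter 0, [primitive] is just (1 - x)^b, and its limit at 1 is known. *)
  apply: (@ge0_integrable_oo _ (fun x => - b^-1 * primitive 0 b x)
    (- b^-1 * (1 - 0) `^ b) (- b^-1 * 0)).
  - exact: measurable_beta_kernel.
  - by move=> x; exact: beta_kernel_continuous.
  - by move=> x _; exact: beta_kernel_ge0.
  - move=> x x01; have /itv01[x0 x1] := x01; have dx := is_derive_onem_powR b x1.
    rewrite (_ : beta_kernel 1 b x = - b^-1 *: (- (b * (1 - x) `^ (b - 1)))).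
      apply: is_deriveZ; rewrite /primitive.
      by under eq_fun do rewrite powRr0 mul1r.
    by rewrite k1' /GRing.scale/= mulrNN mulKf// gt_eqF.
  - apply: cvgMr; rewrite /primitive.
    under eq_fun do rewrite powRr0 mul1r.
    by apply: cvg_at_right_filter; apply: onem_powR_continuous; rewrite subr0.
  - by apply: cvgMr; exact: primitive_cvg1.
(* x + (1 - x) = 1 splits the kernel into two summands with one bounded factor each *)
apply: le_integrable (integrableD _ ia ib) => //.
  by apply: measurable_funTS; apply/measurable_EFinP; exact: measurable_beta_kernel.
move=> x x01; have /itv01[x0 x1] : x \in `]0, 1[ by [].
rewrite /= lee_fin ger0_norm ?beta_kernel_ge0// ger0_norm ?addr_ge0 ?beta_kernel_ge0//.
rewrite k1 k1'.
have le1 c y : 0 < c -> 0 < y -> 0 < 1 - y -> y * y `^ (c - 1) <= 1.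
  move=> c0 y0; rewrite subr_gt0 => y1; rewrite mulr_powRB1 ?(ltW y0)//.
  by rewrite -[leRHS](powRr0 y) ger_powR ?y0 ?ltW.
have -> : beta_kernel a b x = ((1 - x) * (1 - x) `^ (b - 1)) * x `^ (a - 1) +
    (x * x `^ (a - 1)) * (1 - x) `^ (b - 1) by rewrite /beta_kernel; ring.
by rewrite lerD// ger_pMl ?powR_gt0// le1// subKr.
Qed.

Let Rintegral_oo (f F : R -> R) (x y lx ly : R) : x < y ->
  measurable_fun [set: R] f ->
  {in `]x, y[, continuous f} -> {in `]x, y[, forall z, 0 <= f z} ->
  (forall z, z \in `]x, y[ -> is_derive z 1 F (f z)) ->
  F z @[z --> x^'+] --> lx -> F z @[z --> y^'-] --> ly ->
  \int[mu]_(z in `[x, y]) f z = ly - lx.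
Proof.
move=> xy mf cf f0 dF Fx Fy; rewrite /Rintegral integral_itv_bndoo//.
  by rewrite (ge0_continuous_FTC2_oo xy cf f0 dF Fx Fy).
by apply: measurable_funTS; exact/measurable_EFinP.
Qed.

Lemma beta_kernelX n a b x : 0 < a -> 0 <= x ->
  x ^+ n * beta_kernel a b x = beta_kernel (a + n%:R) b x.
Proof.
move=> a0; rewrite le_eqVlt => /predU1P[<-|x0]; rewrite /beta_kernel mulrA.
  case: n => [|n]; first by rewrite addr0 mul1r.
  (* At x = 0 both sides vanish, provided that the exponent a + n - 1 on the right is nonzero: 0 to
     the power 0 would be 1. For positive n this follows from [0 < a]. *)
  rewrite expr0n mul0r powR0// subr_eq0 gt_eqF//.
  by rewrite -natr1 -{1}(add0r 1) addrA ltrD2r ltr_wpDr.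
rewrite -powR_mulrn ?ltW// -powRD; last by rewrite (gt_eqF x0) implybT.
by congr (_ `^ _ * _); ring.
Qed.

(* The derivative of [primitive a b]; it changes sign at a / (a + b), so the two sides
   are integrated separately with [ge0_continuous_FTC2_oo]. *)
Let dprim a b x : R := a * beta_kernel a b x - (a + b) * beta_kernel (a + 1) b x.

Let dprimE a b x : 0 < a -> x \in `]0, 1[ ->
  dprim a b x = beta_kernel a b x * (a - (a + b) * x).
Proof.
move=> a0 /itv01[x0 _]; rewrite /dprim -(@beta_kernelX 1) ?(ltW x0)//; ring.
Qed.

Let integrable_dprim a b : 0 < a -> 0 < b ->
  mu.-integrable `[0, 1] (EFin \o dprim a b).
Proof.
move=> a0 b0; have a1 : 0 < a + 1 by rewrite addr_gt0.
exact: (integrableB _ (integrableZl _ _ (integrable_beta_kernel a0 b0))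
  (integrableZl _ _ (integrable_beta_kernel a1 b0))).
Qed.

Let measurable_dprim a b : measurable_fun [set: R] (dprim a b).
Proof.
by apply: measurable_funB; apply: measurable_funM => //; exact: measurable_beta_kernel.
Qed.

Let dprim_continuous a b x : x \in `]0, 1[ -> {for x, continuous (dprim a b)}.
Proof.
by move=> x01; apply: cvgB; apply: cvgMr; exact: beta_kernel_continuous.
Qed.

Let is_derive_dprim a b x : 0 < a -> x \in `]0, 1[ ->
  is_derive x 1 (primitive a b) (dprim a b x).
Proof. by move=> a0 x01; rewrite dprimE//; exact: is_derive_primitive. Qed.

Let primitive_continuous a b x : x \in `]0, 1[ ->
  {for x, continuous (primitive a b)}.
Proof.
move=> x01; apply/differentiable_continuous/derivable1_diffP.
by apply: ex_derive; exact: is_derive_primitive.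
Qed.

Let ratio a b : 0 < a -> 0 < b -> a / (a + b) \in `]0, 1[.
Proof.
move=> a0 b0; have ab : 0 < a + b by rewrite addr_gt0.
by rewrite in_itv/= divr_gt0//= ltr_pdivrMr// mul1r ltrDl.
Qed.

Let Rintegral_dprim_left a b : 0 < a -> 0 < b ->
  \int[mu]_(x in `[0, a / (a + b)]) dprim a b x = primitive a b (a / (a + b)).
Proof.
move=> a0 b0; have ab : 0 < a + b by rewrite addr_gt0.
have c01 := ratio a0 b0; set c := a / (a + b) in c01 *.
have [c0 /ltW c1] := itv01 c01; rewrite subr_ge0 in c1.
have sub x : x \in `]0, c[ -> x \in `]0, 1[ by apply: subset_itvl; rewrite bnd_simp.
rewrite -[RHS]subr0; apply: (@Rintegral_oo _ (primitive a b)) => //.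
- by move=> x /sub; exact: dprim_continuous.
- move=> x xc; rewrite dprimE ?sub// mulr_ge0 ?beta_kernel_ge0//.
  move: xc; rewrite in_itv/= => /andP[_ xc].
  by rewrite subr_ge0 mulrC -ler_pdivlMr// ltW.
- by move=> x /sub; exact: is_derive_dprim.
- exact: primitive_cvg0.
- by apply: cvg_at_left_filter; exact: primitive_continuous.
Qed.

Let Rintegral_dprim_right a b : 0 < a -> 0 < b ->
  \int[mu]_(x in `[a / (a + b), 1]) dprim a b x = - primitive a b (a / (a + b)).
Proof.
move=> a0 b0; have ab : 0 < a + b by rewrite addr_gt0.
have c01 := ratio a0 b0; set c := a / (a + b) in c01 *.
have [/ltW c0 c1] := itv01 c01; rewrite subr_gt0 in c1.
have sub x : x \in `]c, 1[ -> x \in `]0, 1[ by apply: subset_itvr; rewrite bnd_simp.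
have intf : mu.-integrable `[c, 1] (EFin \o dprim a b).
  apply: integrableS (integrable_dprim a0 b0) => //.
  by apply: subset_itvr; rewrite bnd_simp.
(* To the right of a / (a + b) the derivative is nonpositive, so its opposite is integrated. *)
apply: oppr_inj; rewrite -mulN1r -RintegralZl//.
rewrite opprK -[RHS]opprK -[RHS]sub0r.
rewrite -[X in X - _]oppr0; apply: (@Rintegral_oo _ (fun x => - primitive a b x)) => //.
- by apply: measurable_funM => //; exact: measurable_dprim.
- by move=> x /sub x01; apply: cvgMr; exact: dprim_continuous.
- move=> x xc; rewrite dprimE ?sub// mulN1r -mulrN mulr_ge0 ?beta_kernel_ge0//.
  move: xc; rewrite in_itv/= => /andP[xc _].
  by rewrite oppr_ge0 subr_le0 mulrC -ler_pdivrMr// ltW.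
- by move=> x /sub x01; rewrite mulN1r; apply: is_deriveN; exact: is_derive_dprim.
- by apply: cvgN; apply: cvg_at_right_filter; exact: primitive_continuous.
- by apply: cvgN; exact: primitive_cvg1.
Qed.

Let Rintegral_dprim_split a b : 0 < a -> 0 < b ->
  \int[mu]_(x in `[0, 1]) dprim a b x -
    \int[mu]_(x in `[0, a / (a + b)]) dprim a b x =
  \int[mu]_(x in `[a / (a + b), 1]) dprim a b x.
Proof.
move=> a0 b0; have /itv01[c0 c1] := ratio a0 b0; rewrite subr_gt0 in c1.
rewrite Rintegral_itvB ?bnd_simp ?ltW//; last exact: integrable_dprim.
rewrite Rintegral_itv_obnd_cbnd//.
apply: integrableS (integrable_dprim a0 b0) => //.
by apply: subset_itvr; rewrite bnd_simp ltW.
Qed.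

(** The integral of the derivative of x^a (1 - x)^b over the whole interval is zero, because the
    contributions of the two sides of a / (a + b) cancel. *)
Lemma beta_integral_recl a b : 0 < a -> 0 < b ->
  (a + b) * beta_integral (a + 1) b = a * beta_integral a b.
Proof.
move=> a0 b0; have a1 : 0 < a + 1 by rewrite addr_gt0.
have : \int[mu]_(x in `[0, 1]) dprim a b x = 0.
  have /eqP := Rintegral_dprim_split a0 b0.
  rewrite [X in _ - X](Rintegral_dprim_left a0 b0).
  by rewrite [X in _ == X](Rintegral_dprim_right a0 b0) subr_eq addNr => /eqP.
have -> : \int[mu]_(x in `[0, 1]) dprim a b x =
    a * beta_integral a b - (a + b) * beta_integral (a + 1) b.
  rewrite /beta_integral -(RintegralZl a _ (integrable_beta_kernel a0 b0))//.
  rewrite -(RintegralZl (a + b) _ (integrable_beta_kernel a1 b0))//.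
  apply: RintegralB => //.
    exact: integrableZl (integrable_beta_kernel a0 b0).
  exact: integrableZl (integrable_beta_kernel a1 b0).
by move/subr0_eq.
Qed.

(** On [0, a / (a + b)] the function [dprim] is at most [a] times the kernel, and its integral there
    is the positive value of [primitive] at the right end; the rest of the interval contributes a
    nonnegative amount. *)
Lemma beta_integral_gt0 a b : 0 < a -> 0 < b -> 0 < beta_integral a b.
Proof.
move=> a0 b0; have /itv01[c0 c1] := ratio a0 b0; rewrite subr_gt0 in c1.
have intk := integrable_beta_kernel a0 b0.
have sub : `[0, a / (a + b)] `<=` `[0, 1].
  by apply: subset_itvl; rewrite bnd_simp ltW.
have le : \int[mu]_(x in `[0, a / (a + b)]) dprim a b x <=
    \int[mu]_(x in `[0, a / (a + b)]) (a * beta_kernel a b x).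
  apply: le_Rintegral => //.
  - exact: integrableS (integrable_dprim a0 b0).
  - exact: integrableS (integrableZl _ _ intk).
  - move=> x _; rewrite gerBl mulr_ge0 ?beta_kernel_ge0//.
    by rewrite ltW// addr_gt0.
have : 0 < \int[mu]_(x in `[0, a / (a + b)]) dprim a b x.
  by rewrite Rintegral_dprim_left// mulr_gt0 ?powR_gt0// subr_gt0.
move=> /lt_le_trans/(_ le); rewrite RintegralZl//; last exact: integrableS intk.
rewrite pmulr_rgt0// => pos; apply: (lt_le_trans pos).
have ge0 : 0 <= \int[mu]_(x in `]a / (a + b), 1]) beta_kernel a b x.
  by apply: Rintegral_ge0 => x _; exact: beta_kernel_ge0.
rewrite -subr_ge0; apply: (le_trans ge0).
by rewrite -(Rintegral_itvB intk) ?bnd_simp ?ltW.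
Qed.

End beta_integral.

(** * Hankel determinants of hypergeometric moments *)

Section hankel_determinant.
Context {F : numFieldType}.
Variables (m : nat -> F) (N : nat).

Definition shifted_hankel (e : 'I_N -> nat) : 'M[F]_N :=
  \matrix_(i, j) m (e i + j).

Definition hankel_det : F := \det (shifted_hankel (fun i => i)).

(** The counterpart of the k-th power sum: the summand x_r^k raises the moments of row r by k. *)
Definition hankel_sum k : F :=
  \sum_(r < N) \det (shifted_hankel (fun i => i + (i == r) * k)%N).

(* Integrating the square of the Vandermonde determinant times the monomial with
   exponents e against a product weight with moments m; one of the two determinants is
   expanded over the permutations s. *)
Definition alternating_sum (e : 'I_N -> nat) : F :=
  \sum_(s : 'S_N) (-1) ^+ s * \det (shifted_hankel (fun i => s i + e i)%N).

Lemma det_shifted_hankel_perm (s : 'S_N) (e : 'I_N -> nat) :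
  \det (shifted_hankel (fun i => s i + e (s i))%N) =
  (-1) ^+ s * \det (shifted_hankel (fun i => i + e i)%N).
Proof.
have -> : shifted_hankel (fun i => s i + e (s i))%N =
    row_perm s (shifted_hankel (fun i => i + e i)%N).
  by apply/matrixP => i j; rewrite !mxE.
by rewrite row_permE det_mulmx det_perm.
Qed.

Lemma alternating_sum0 : alternating_sum (fun=> 0%N) =
  N`!%:R * hankel_det.
Proof.
rewrite /alternating_sum (eq_bigr (fun=> hankel_det)).
  by rewrite sumr_const card_Sn mulr_natl.
move=> s _; rewrite (det_shifted_hankel_perm s (fun=> 0%N)) signrMK.
by congr (\det _); apply/matrixP => i j; rewrite !mxE addn0.
Qed.

(** For a fixed permutation s, sorting the rows moves the shift from row r to row [s r]. Summing
    over r absorbs this move, and the two signs cancel, so all N! permutations contribute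
    equally. *)
Lemma sum_alternating_sum k :
  \sum_(r < N) alternating_sum (fun i => (i == r) * k)%N =
  N`!%:R * hankel_sum k.
Proof.
rewrite /hankel_sum exchange_big/= (eq_bigr (fun=> \sum_(r < N)
  \det (shifted_hankel (fun i => i + (i == r) * k)%N))).
  by rewrite sumr_const card_Sn mulr_natl.
move=> s _; rewrite [RHS](reindex_inj (@perm_inj _ s)); apply: eq_bigr => r _.
rewrite -[RHS](signrMK s) -(det_shifted_hankel_perm s (fun i => (i == s r) * k)%N).
congr (_ * \det _); apply/matrixP => i j; rewrite !mxE.
by rewrite (inj_eq perm_inj).
Qed.

End hankel_determinant.

Lemma prod_binomial (F : numFieldType) n k :
  \prod_(0 <= v < n) ((v%:R + 1 + k%:R) / (v%:R + 1)) = 'C(n + k, k)%:R :> F.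
Proof.
elim: n => [|n IH]; first by rewrite big_geq// add0n binn.
rewrite big_nat_recr//= IH; apply: (mulIf (_ : n%:R + 1 != 0)).
  by rewrite natr1 pnatr_eq0.
rewrite mulrA divfK ?natr1 ?pnatr_eq0// -natrD -!natrM.
have := mul_bin_down (n.+1 + k) k.
rewrite addnK addSn/= => e; congr (_%:R).
by rewrite mulnC [RHS]mulnC.
Qed.

(** The factors with u > s multiply to the binomial coefficient of N - s - 1 + k over k. Its
    symmetry trades these N - s - 1 factors for k factors, a number that does not depend on N. *)
Lemma prod_shifted_ratio (F : numFieldType) N k (s : 'I_N) :
  \prod_(u < N | u != s) ((u%:R - s%:R + k%:R) / (u%:R - s%:R)) =
  \prod_(0 <= u < s) ((u%:R - s%:R + k%:R) / (u%:R - s%:R)) *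
  \prod_(0 <= t < k) ((t%:R + N%:R - s%:R) / (t%:R + 1)) :> F.
Proof.
rewrite -(big_mkord (fun u => u != s :> nat) (fun u => (u%:R - s%:R + k%:R) / (u%:R - s%:R))).
have sN := ltn_ord s.
rewrite (@big_cat_nat _ _ _ s)//= ?(ltnW sN)//; congr (_ * _).
  rewrite big_nat_cond [RHS]big_nat_cond; apply: eq_bigl => u.
  by case: (ltnP u s) => us; rewrite ?andbF// ltn_eqF.
rewrite big_mkcond big_ltn//= eqxx mul1r -{1}(add0n s.+1) big_addn.
transitivity (\prod_(0 <= v < N - s.+1) ((v%:R + 1 + k%:R) / (v%:R + 1)) : F).
  apply: eq_bigr => v _; rewrite ifT; last by rewrite gtn_eqF// addnS ltnS leq_addl.
  by rewrite natrD -[s.+1%:R]natr1; congr (_ / _); ring.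
rewrite prod_binomial -bin_sub ?leq_addl// addnK addnC -prod_binomial.
apply: eq_bigr => t _; rewrite natrB// -[s.+1%:R]natr1.
by congr (_ / _); ring.
Qed.

(** * Lagrange interpolation for moments with a hypergeometric recurrence *)

Section hypergeometric_hankel.
Context {F : numFieldType}.
Variables (a b : F) (m : nat -> F) (N : nat).
Hypotheses (a0 : 0 < a) (b0 : 0 < b) (m_neq0 : forall n, m n != 0).
Hypothesis m_rec : forall n, (a + b + n%:R) * m n.+1 = (a + n%:R) * m n.
Hypothesis N0 : (0 < N)%N.

Let M := @shifted_hankel F m N (fun i => i).

Let ab_gt0 n : 0 < a + b + n%:R.
Proof. by rewrite ltr_wpDr// addr_gt0. Qed.

(* [m (n + j)] is [row_scale n] times the value of [col_poly j] at n. *)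
Let col_poly j : {poly F} :=
  \prod_(0 <= t < j) ('X + (a + t%:R)%:P) *
  \prod_(j <= t < N.-1) ('X + (a + b + t%:R)%:P).

Let row_scale n := m n / \prod_(0 <= t < N.-1) (a + b + (n + t)%:R).

Let row_scale_neq0 n : row_scale n != 0.
Proof.
rewrite mulf_neq0// invr_neq0// prodf_seq_neq0; apply/allP => t _ /=.
by rewrite gt_eqF.
Qed.

Let moment_shift n j :
  m (n + j) * \prod_(0 <= t < j) (a + b + (n + t)%:R) =
  m n * \prod_(0 <= t < j) (a + (n + t)%:R).
Proof.
elim: j => [|j IH]; first by rewrite !big_geq// addn0.
rewrite !big_nat_recr//= [RHS]mulrA -IH addnS.
by rewrite [RHS]mulrAC [m (n + j) * _]mulrC -m_rec; ring.
Qed.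

Let hornerXaddC (c x : F) : ('X + c%:P).[x] = x + c.
Proof. by rewrite hornerD hornerX hornerC. Qed.

(** The recurrence gives m (n + j) / m n a denominator of j factors. Completing it to N - 1 factors
    makes it independent of j, and the added factors reappear in [col_poly j]. *)
Let moment_col_poly n j : (j < N)%N ->
  m (n + j) = row_scale n * (col_poly j).[n%:R].
Proof.
move=> jN; rewrite /row_scale /col_poly hornerM !horner_prod.
have jN' : (j <= N.-1)%N by rewrite -ltnS prednK.
rewrite (@big_cat_nat _ _ _ j _ _ predT _ _ jN')//=.
under [X in _ = _ * (X * _)]eq_bigr do rewrite hornerXaddC addrCA -natrD.
under [X in _ = _ * (_ * X)]eq_bigr do rewrite hornerXaddC addrCA -natrD.
set A := \prod_(0 <= t < j) (a + b + _); set B := \prod_(j <= t < N.-1) _.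
have A0 : A != 0.
  by rewrite prodf_seq_neq0; apply/allP => t _ /=; rewrite gt_eqF.
have B0 : B != 0.
  by rewrite prodf_seq_neq0; apply/allP => t _ /=; rewrite gt_eqF.
apply: (mulIf A0); rewrite moment_shift -/A.
set C := \prod_(0 <= t < j) _.
clearbody A B C.
by field; rewrite A0 B0.
Qed.

Let size_col_poly j : (j < N)%N -> (size (col_poly j) <= N)%N.
Proof.
move=> jN; have jN' : (j <= N.-1)%N by rewrite -ltnS prednK.
have szp c d (e : nat -> F) : size (\prod_(c <= t < d) ('X + (e t)%:P)) = (d - c).+1.
  under eq_bigr do rewrite -[e _]opprK polyCN.
  by rewrite size_prod_XsubC size_iota.
rewrite (leq_trans (size_polyMleq _ _))// !szp subn0 addSn addnS/=.
by rewrite subnKC// prednK.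
Qed.

Let lag := @lagrange F N (fun i => i%:R).

Let natr_inj : injective (fun i : nat => i%:R : F).
Proof. exact: mulrIn (oner_neq0 F). Qed.

Let interpolation j x : (j < N)%N ->
  (col_poly j).[x] = \sum_(i < N) (col_poly j).[i%:R] * (tnth lag i : {poly F}).[x].
Proof.
move=> jN; rewrite {1}(lagrange_gen N0 natr_inj (size_col_poly jN)).
by rewrite horner_sum; apply: eq_bigr => i _; rewrite !hornerE.
Qed.

(** Interpolation at r + k from the nodes 0, ..., N - 1 writes the shifted row as a combination of
    the rows of [M]; in the determinant only the coefficient of row r itself survives. *)
Lemma det_shifted_hankel k (r : 'I_N) :
  \det (shifted_hankel m (fun i => i + (i == r) * k)%N) =
  row_scale (r + k) / row_scale r * (tnth lag r : {poly F}).[(r + k)%:R] * \det M.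
Proof.
rewrite (expand_det_row _ r).
pose y (i : 'I_N) := row_scale (r + k) / row_scale i * (tnth lag i : {poly F}).[(r + k)%:R].
transitivity (\sum_j \sum_i y i * (M i j * (\adj M) j r)).
  apply: eq_bigr => j _; rewrite !mxE eqxx mul1n.
  (* The cofactors along row r omit that row, hence do not see the shift. *)
  have -> : cofactor (shifted_hankel m (fun i => i + (i == r) * k)%N) r j = cofactor M r j.
    congr (_ * \det _); apply/matrixP => i i'; rewrite !mxE.
    by rewrite eq_sym (negPf (neq_lift _ _)) mul0n addn0.
  rewrite moment_col_poly// interpolation// mulr_sumr mulr_suml.
  apply: eq_bigr => i _; rewrite mulrA; congr (_ * _).
  rewrite mxE moment_col_poly// /y.
  by field; exact: row_scale_neq0.
have adjE i : \sum_j M i j * (\adj M) j r = (\det M) *+ (i == r).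
  by have /matrixP/(_ i r) := mul_mx_adj M; rewrite [LHS]mxE [RHS]mxE.
rewrite exchange_big/=; under eq_bigr do rewrite -mulr_sumr adjE.
rewrite (bigD1 r)//= eqxx mulr1n big1 ?addr0// => i /negPf ->.
by rewrite mulr0n mulr0.
Qed.

Lemma hankel_det_neq0 : hankel_det m N != 0.
Proof.
(* Evaluating the column polynomials at -a, -a-1, ... gives a triangular matrix. *)
pose H : 'M[F]_N := \matrix_(l, j) (col_poly j).[- a - l%:R].
have HE : H = (\matrix_(l, i) ((tnth lag i : {poly F}).[- a - l%:R] / row_scale i)) *m M.
  apply/matrixP => l j; rewrite !mxE interpolation//; apply: eq_bigr => i _.
  by rewrite !mxE moment_col_poly//; field; exact: row_scale_neq0.
suff : \det H != 0 by rewrite /hankel_det -/M HE det_mulmx mulf_eq0 => /norP[].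
rewrite det_trig; last first.
  apply/is_trig_mxP => l j lj; rewrite mxE /col_poly hornerM horner_prod.
  rewrite (bigD1_seq (l : nat)) ?iota_uniq ?mem_index_iota//= hornerXaddC.
  by rewrite (_ : - a - l%:R + (a + l%:R) = 0) ?mul0r//; ring.
(* On the diagonal the factors are t - l with t < l, then b + (t - l) with t >= l, and the latter
   are positive. *)
apply/prodf_neq0 => l _; rewrite mxE /col_poly hornerM !horner_prod mulf_neq0//.
  rewrite prodf_seq_neq0; apply/allP => t; rewrite mem_index_iota/= => tl.
  rewrite hornerXaddC (_ : - a - l%:R + (a + t%:R) = t%:R - l%:R); last by ring.
  by rewrite subr_eq0 eqr_nat ltn_eqF.
rewrite prodf_seq_neq0; apply/allP => t; rewrite mem_index_iota => /andP[lt _]/=.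
rewrite hornerXaddC (_ : - a - l%:R + (a + b + t%:R) = b + (t%:R - l%:R)); last by ring.
by rewrite gt_eqF// ltr_wpDr// subr_ge0 ler_nat.
Qed.

(** The two denominators of N - 1 consecutive factors overlap. Splitting the product of N - 1 + k
    factors from r on in two ways ([PP]) leaves only k of them. *)
Let row_scale_ratio r k :
  row_scale (r + k) / row_scale r =
  \prod_(0 <= t < k) ((a + (r + t)%:R) / (a + b + (r + N.-1 + t)%:R)).
Proof.
pose P c d := \prod_(0 <= t < d) (a + b + (c + t)%:R).
have P0 c d : P c d != 0.
  by rewrite prodf_seq_neq0; apply/allP => t _ /=; rewrite gt_eqF.
have PD c d d' : P c (d + d')%N = P c d * P (c + d)%N d'.
  rewrite /P (@big_cat_nat _ _ _ d)//= ?leq_addr//; congr (_ * _).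
  rewrite -{1}[d]add0n big_addn addKn; apply: eq_bigr => t _.
  by rewrite -addnA [(t + d)%N]addnC.
have PP : P r k * P (r + k)%N N.-1 = P r N.-1 * P (r + N.-1)%N k.
  by rewrite -!PD addnC.
rewrite big_split/= prodfV -/(P _ k) /row_scale -/(P _ N.-1) -/(P _ N.-1).
have := moment_shift r k; rewrite -/(P r k).
set A := \prod_(0 <= t < k) _ => e.
have -> : m (r + k) = m r * A / P r k by rewrite -e mulfK.
move: PP (m_neq0 r) (P0 r k) (P0 (r + k)%N N.-1) (P0 r N.-1) (P0 (r + N.-1)%N k).
move: (P r k) (P (r + k)%N N.-1) (P r N.-1) (P (r + N.-1)%N k) (m r) => x y z t u PP u0 x0 y0 z0 _.
have -> : t = x * y / z by rewrite PP mulrC mulKf.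
by clearbody A; field; rewrite u0 x0 y0 z0.
Qed.

(** Rows are counted from the last one, so that for fixed s the second product is an explicit
    function of N, and the contributing rows will be those with s < k. *)
Lemma det_shifted_hankel_ratio k (s : 'I_N) :
  \det (shifted_hankel m (fun i => i + (i == rev_ord s) * k)%N) / \det M =
  \prod_(u < N | u != s) ((u%:R - s%:R + k%:R) / (u%:R - s%:R)) *
  \prod_(0 <= t < k)
    ((a + (N%:R - 1 - s%:R + t%:R)) / (a + b + (2 * (N%:R - 1) - s%:R + t%:R))).
Proof.
rewrite det_shifted_hankel mulfK ?hankel_det_neq0// mulrC; congr (_ * _); last first.
  rewrite row_scale_ratio; apply: eq_bigr => t _ /=.
  rewrite !natrD natrB// -subn1 natrB// -[s.+1%:R]natr1.
  by congr (_ / _); ring.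
rewrite lagrangeE//= hornerM hornerC !horner_prod mulrC -prodf_div.
rewrite (reindex_inj rev_ord_inj)/=; apply: eq_big => [u|u us].
  by rewrite (inj_eq rev_ord_inj).
rewrite !hornerXsubC natrD !natrB// -[u.+1%:R]natr1 -[s.+1%:R]natr1.
by congr (_ / _); ring.
Qed.

Lemma hankel_ratio k : (0 < k <= N)%N ->
  hankel_sum m N k / hankel_det m N = \sum_(s < k)
    \prod_(0 <= u < s) ((u%:R - s%:R + k%:R) / (u%:R - s%:R)) *
    \prod_(0 <= t < k) ((t%:R + N%:R - s%:R) / (t%:R + 1)) *
    \prod_(0 <= t < k) ((a + (N%:R - 1 - s%:R + t%:R)) /
                        (a + b + (2 * (N%:R - 1) - s%:R + t%:R))).
Proof.
move=> /andP[k0 kN].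
rewrite /hankel_sum /hankel_det -/M (reindex_inj rev_ord_inj) mulr_suml.
etransitivity; first by apply: eq_bigr => s _; exact: det_shifted_hankel_ratio.
rewrite [RHS](big_ord_widen _ (fun s =>
    \prod_(0 <= u < s) ((u%:R - s%:R + k%:R) / (u%:R - s%:R)) *
    \prod_(0 <= t < k) ((t%:R + N%:R - s%:R) / (t%:R + 1)) *
    \prod_(0 <= t < k) ((a + (N%:R - 1 - s%:R + t%:R)) /
                        (a + b + (2 * (N%:R - 1) - s%:R + t%:R)))) kN).
rewrite [RHS]big_mkcond/=; apply: eq_bigr => s _; case: ifPn => [_|].
  by rewrite prod_shifted_ratio.
rewrite -leqNgt => ks.
(* For s >= k the point r + k, with r = N - 1 - s, is itself a node, and the factor with u = s - k
   is zero. *)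
have skN : (s - k < N)%N by rewrite (leq_ltn_trans (leq_subr _ _)).
rewrite (bigD1 (Ordinal skN))/=; last first.
  by rewrite -val_eqE/= ltn_eqF// ltn_subrL k0 (leq_trans k0 ks).
by rewrite natrB// (_ : _ - _ - _ + _ = 0) ?mul0r//; ring.
Qed.

End hypergeometric_hankel.

(** * Bounded rational functions *)

Section eventually_rational.
Context {R : realType}.
Implicit Types (f g : nat -> R) (P Q : {poly R}).

(** Asking for this only near infinity discards the N below k, and the condition on [Q] rules out
    the default value of division by 0. *)
Definition eventually_rational f := exists P Q,
  \forall n \near \oo, Q.[n%:R] != 0 /\ f n = P.[n%:R] / Q.[n%:R].

Lemma near_eq_rational f g : (\forall n \near \oo, f n = g n) ->
  eventually_rational f -> eventually_rational g.
Proof.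
move=> fg [P [Q PQ]]; exists P, Q; near=> n.
have <- : f n = g n by near: n.
by near: n.
Unshelve. all: by end_near. Qed.

Lemma rational_cst c : eventually_rational (fun=> c).
Proof.
by exists c%:P, 1; near=> n; rewrite !hornerE oner_neq0 divr1.
Unshelve. all: by end_near. Qed.

Lemma rational_natr : eventually_rational (fun n => n%:R).
Proof.
by exists 'X, 1; near=> n; rewrite !hornerE oner_neq0 divr1.
Unshelve. all: by end_near. Qed.

Lemma rationalD f g : eventually_rational f -> eventually_rational g ->
  eventually_rational (fun n => f n + g n).
Proof.
move=> [P [Q PQ]] [P' [Q' PQ']]; exists (P * Q' + P' * Q), (Q * Q'); near=> n.
have [Q0 ->] : Q.[n%:R] != 0 /\ f n = P.[n%:R] / Q.[n%:R] by near: n.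
have [Q0' ->] : Q'.[n%:R] != 0 /\ g n = P'.[n%:R] / Q'.[n%:R] by near: n.
by rewrite hornerD !hornerM mulf_neq0// addf_div.
Unshelve. all: by end_near. Qed.

Lemma rationalM f g : eventually_rational f -> eventually_rational g ->
  eventually_rational (fun n => f n * g n).
Proof.
move=> [P [Q PQ]] [P' [Q' PQ']]; exists (P * P'), (Q * Q'); near=> n.
have [Q0 ->] : Q.[n%:R] != 0 /\ f n = P.[n%:R] / Q.[n%:R] by near: n.
have [Q0' ->] : Q'.[n%:R] != 0 /\ g n = P'.[n%:R] / Q'.[n%:R] by near: n.
by rewrite !hornerM mulf_neq0// mulf_div.
Unshelve. all: by end_near. Qed.

Lemma rationalV f : (\forall n \near \oo, f n != 0) -> eventually_rational f ->
  eventually_rational (fun n => (f n)^-1).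
Proof.
move=> f0 [P [Q PQ]]; exists Q, P; near=> n.
have : f n != 0 by near: n.
have [Q0 ->] : Q.[n%:R] != 0 /\ f n = P.[n%:R] / Q.[n%:R] by near: n.
by rewrite mulf_eq0 negb_or invf_div => /andP[].
Unshelve. all: by end_near. Qed.

Lemma rational_sum (I : Type) (r : seq I) (F : I -> nat -> R) :
  (forall i, eventually_rational (F i)) ->
  eventually_rational (fun n => \sum_(i <- r) F i n).
Proof.
move=> ratF; elim: r => [|i r IH].
  by under eq_fun do rewrite big_nil; exact: rational_cst.
by under eq_fun do rewrite big_cons; exact: rationalD.
Qed.

Lemma rational_prod (I : Type) (r : seq I) (F : I -> nat -> R) :
  (forall i, eventually_rational (F i)) ->
  eventually_rational (fun n => \prod_(i <- r) F i n).
Proof.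
move=> ratF; elim: r => [|i r IH].
  by under eq_fun do rewrite big_nil; exact: rational_cst.
by under eq_fun do rewrite big_cons; exact: rationalM.
Qed.

Lemma cvg_natrVX d : (n%:R : R)^-1 ^+ d.+1 @[n --> \oo] --> 0.
Proof.
have cvgV : (n%:R : R)^-1 @[n --> \oo] --> 0.
  apply/gtr0_cvgV0; last exact: cvgr_idn.
  by near=> n; rewrite ltr0n; near: n; exact: nbhs_infty_gt.
elim: d => [|d IH]; first by under eq_fun do rewrite expr1.
under eq_fun do rewrite exprS; rewrite -(mulr0 0); exact: cvgM.
Unshelve. all: by end_near. Qed.

(** The size is only bounded above, so the limit is the leading coefficient in degree d and 0 in
    smaller degree. Both cases are used below. *)
Lemma cvg_poly_div P d : (size P <= d.+1)%N ->
  P.[n%:R] * n%:R^-1 ^+ d @[n --> \oo] --> P`_d.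
Proof.
elim: d P => [|d IH] P sP.
  rewrite (size1_polyC sP) coefC/=.
  by under eq_fun do rewrite hornerC mulr1; exact: cvg_cst.
elim/poly_ind: P sP => [|P c _] sP.
  by rewrite coef0; under eq_fun do rewrite horner0 mul0r; exact: cvg_cst.
have {}sP : (size P <= d.+1)%N.
  by move: sP; rewrite size_MXaddC; case: ifP => [/andP[/eqP -> _]|_]; rewrite ?size_poly0.
rewrite coefD coefMX coefC/=.
have : P.[n%:R] * n%:R^-1 ^+ d + c * n%:R^-1 ^+ d.+1 @[n --> \oo] --> P`_d + c * 0.
  by apply: cvgD; [exact: IH|apply: cvgMr; exact: cvg_natrVX].
rewrite mulr0; apply: cvg_trans; apply: near_eq_cvg; near=> n.
have n0 : n%:R != 0 :> R by rewrite pnatr_eq0 -lt0n; near: n; exact: nbhs_infty_gt.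
by rewrite hornerMXaddC mulrDl; congr (_ + _); rewrite exprS mulrA mulfK.
Unshelve. all: by end_near. Qed.

(** Boundedness forces the degree of [P] to be at most that of [Q]; dividing both by n to the degree
    of [Q] then gives the limit. *)
Lemma cvg_bounded_rational f B : eventually_rational f ->
  (\forall n \near \oo, `|f n| <= B) -> exists l : R, f @ \oo --> l.
Proof.
move=> [P [Q PQ]] fB.
have Q0 : Q != 0.
  have [n _ /(_ n (leqnn n)) [Qn _]] := PQ.
  by apply: contraNneq Qn => ->; rewrite horner0.
pose d := (size Q).-1.
have sQ : size Q = d.+1 by rewrite prednK// size_poly_gt0.
have sP : (size P <= d.+1)%N.
  rewrite leqNgt; apply/negP => sP.
  have P0 : P != 0 by rewrite -size_poly_gt0 (leq_trans _ sP).
  (* With e the degree of [P], supposed larger than that of [Q], dividing |P(n)| <= B |Q(n)| by n^e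
     and passing to the limit makes the leading coefficient of [P] zero. *)
  pose e := (size P).-1; have se : size P = e.+1 by rewrite prednK// size_poly_gt0.
  have sQe : (size Q <= e)%N by rewrite sQ -ltnS -se.
  have cP : `|P.[n%:R] * n%:R^-1 ^+ e| @[n --> \oo] --> `|P`_e|.
    by apply: cvg_norm; apply: cvg_poly_div; rewrite se.
  have cQ : B * `|Q.[n%:R] * n%:R^-1 ^+ e| @[n --> \oo] --> B * `|Q`_e|.
    by apply: cvgMr; apply: cvg_norm; apply: cvg_poly_div; rewrite leqW.
  have : `|P`_e| <= B * `|Q`_e|.
    apply: ler_cvg_to cP cQ _; near=> n.
    have [Qn fn] : Q.[n%:R] != 0 /\ f n = P.[n%:R] / Q.[n%:R] by near: n.
    have : `|f n| <= B by near: n.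
    rewrite fn normrM normfV ler_pdivrMr ?normr_gt0// => PQn.
    by rewrite !normrM mulrA ler_wpM2r.
  rewrite [Q`_e]nth_default// normr0 mulr0 normr_le0.
  by rewrite -[_`_e]/(lead_coef P) lead_coef_eq0 (negPf P0).
exists (P`_d / Q`_d).
have cPQ : (P.[n%:R] * n%:R^-1 ^+ d) / (Q.[n%:R] * n%:R^-1 ^+ d) @[n --> \oo] -->
    P`_d / Q`_d.
  apply: cvgM; first exact: cvg_poly_div.
  apply: cvgV; last by apply: cvg_poly_div; rewrite sQ.
  by rewrite -[_`_d]/(lead_coef Q) lead_coef_eq0.
apply: cvg_trans cPQ; apply: near_eq_cvg; near=> n.
have [Qn ->] : Q.[n%:R] != 0 /\ f n = P.[n%:R] / Q.[n%:R] by near: n.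
have n0 : n%:R^-1 ^+ d != 0 :> R.
  rewrite expf_neq0// invr_neq0// pnatr_eq0 -lt0n.
  by near: n; exact: nbhs_infty_gt.
by rewrite -mulf_div divff// mulr1.
Unshelve. all: by end_near. Qed.

End eventually_rational.

(** * Jacobi averages *)

Section iterated_integral.
Context {R : realType}.
Notation mu := (@lebesgue_measure R).

Lemma iint_ge0 n (F : (nat -> R) -> R) :
  (forall v, (forall i, (i < n)%N -> 0 <= v i <= 1) -> 0 <= F v) -> 0 <= iint n F.
Proof.
elim: n F => [F F0|n IH F F0]; first exact: F0.
apply: Rintegral_ge0 => x /=; rewrite in_itv/= => x01; apply: IH => v v01.
by apply: F0 => -[//|i]; exact: v01.
Qed.

(** For a finite sum of separated products, linearity of the one-dimensional integral suffices. The
    coefficients [c] vary in the induction, where they absorb the value of the factor in the first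
    coordinate. *)
Lemma iint_sum_prod (T : Type) (r : seq T) n (c : T -> R) (h : T -> nat -> R -> R) :
  (forall t i, mu.-integrable `[0, 1] (EFin \o h t i)) ->
  iint n (fun v => \sum_(t <- r) c t * \prod_(i < n) h t i (v i)) =
  \sum_(t <- r) c t * \prod_(i < n) \int[mu]_(x in `[0, 1]) h t i x.
Proof.
elim: n c h => [c h _|n IH c h inth] /=.
  by apply: eq_bigr => t _; rewrite !big_ord0.
transitivity (\int[mu]_(x in `[0%R, 1%R]) \sum_(t <- r) (c t *
    \prod_(i < n) \int[mu]_(x in `[0, 1]) h t i.+1 x) * h t 0%N x).
  apply: eq_Rintegral => x _.
  rewrite (_ : (fun v : nat -> R => _) = (fun v : nat -> R => \sum_(t <- r) (c t * h t 0%N x) *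
      \prod_(i < n) h t i.+1 (v i))); last first.
    apply/funext => v; apply: eq_bigr => t _.
    by rewrite big_ord_recl /= mulrA.
  rewrite (IH (fun t => c t * h t 0%N x) (fun t i => h t i.+1))//.
  by apply: eq_bigr => t _; rewrite mulrAC.
elim: r {IH} => [|t r IHr].
  rewrite big_nil; under eq_Rintegral do rewrite big_nil.
  by rewrite Rintegral_cst// mul0r.
have intZ k s : mu.-integrable `[0, 1] (EFin \o (fun x => k * h s 0%N x)).
  exact: integrableZl (inth s 0%N).
rewrite big_cons -IHr big_ord_recl mulrCA [_ * (c t * _)]mulrC.
under eq_Rintegral do rewrite big_cons.
rewrite -[X in _ = X + _]RintegralZl//.
apply: RintegralD => //.
rewrite [X in mu.-integrable _ X](_ : _ = fun x => (\sum_(s <- r) (c s *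
    \prod_(i < n) \int[mu]_(x in `[0, 1]) h s i.+1 x * h s 0%N x)%:E)%E); last first.
  by apply/funext => x; rewrite /= -sumEFin.
by apply: integrable_sum => // s _; exact: intZ.
Qed.

End iterated_integral.

(** * Andreief's identity for the Jacobi weight *)

Section jacobi_determinant.
Context {R : realType}.
Variables (a b : R) (N : nat).
Hypotheses (a0 : 0 < a) (b0 : 0 < b).
Notation mu := (@lebesgue_measure R).

Definition beta_moment n : R := beta_integral (a + n%:R) b.

Lemma jacobi_weightE v :
  jacobi_weight N a b v =
  (\det (\matrix_(i < N, j < N) v i ^+ j)) ^+ 2 * \prod_(i < N) beta_kernel a b (v i).
Proof.
rewrite /jacobi_weight; congr (_ * _); last by rewrite big_mkord.
rewrite -det_tr (_ : _^T = Vandermonde N (\row_j v j)); last first.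
  by apply/matrixP => i j; rewrite !mxE.
rewrite det_Vandermonde -prodrXl big_mkord; apply: eq_bigr => i _.
rewrite -prodrXl (big_nat_widenl _ 0%N)//= big_mkord; apply: eq_bigr => j _.
by rewrite !mxE -sqrrN opprB.
Qed.

(** Both Vandermonde determinants are expanded over permutations s1 and s2, each monomial integrates
    to a product of moments, and the sum over s2 is again a determinant. Arbitrary finite
    combinations of monomials cover 1, p_k and N - p_k at once. *)
Lemma iint_monomials (T : finType) (c : T -> R) (e : T -> 'I_N -> nat) :
  iint N (fun v => (\sum_t c t * \prod_(i < N) v i ^+ e t i) *
                   jacobi_weight N a b v) =
  \sum_t c t * alternating_sum beta_moment (e t).
Proof.
(* [iint_sum_prod] indexes its factors by natural numbers, permutations act on ['I_N]: [insub]
   mediates, and the value 0 out of range keeps [h] integrable. *)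
pose h (t : T * ('S_N * 'S_N)) (n : nat) (x : R) : R :=
  if insub n is Some i then x ^+ (t.2.1 i + e t.1 i + t.2.2 i) * beta_kernel a b x
  else 0.
pose d (t : T * ('S_N * 'S_N)) : R := c t.1 * ((-1) ^+ t.2.1 * (-1) ^+ t.2.2).
have hE t (i : 'I_N) : h t i = fun x => x ^+ (t.2.1 i + e t.1 i + t.2.2 i) * beta_kernel a b x.
  by rewrite /h valK.
have inth t n : mu.-integrable `[0, 1] (EFin \o h t n).
  rewrite /h; case: insubP => [i _ _|_]; last exact: integrable0.
  set m := (_ + _)%N; have am : 0 < a + m%:R by rewrite ltr_wpDr.
  apply: eq_integrable (integrable_beta_kernel am b0) => // x.
  by rewrite inE/= in_itv/= => /andP[x0 _]; rewrite beta_kernelX.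
transitivity (iint N (fun v => \sum_t d t * \prod_(i < N) h t i (v i))).
  congr iint; apply/funext => v; rewrite jacobi_weightE expr2 /determinant.
  rewrite mulr_suml -(pair_bigA _ (fun t p => d (t, p) * \prod_(i < N) h (t, p) i (v i)))/=.
  apply: eq_bigr => t _.
  rewrite -(pair_bigA _ (fun s1 s2 => d (t, (s1, s2)) *
    \prod_(i < N) h (t, (s1, s2)) i (v i)))/=.
  rewrite !mulr_suml mulr_sumr; apply: eq_bigr => s1 _.
  rewrite mulr_sumr mulr_suml mulr_sumr; apply: eq_bigr => s2 _.
  under [in RHS]eq_bigr do rewrite hE/= !exprD.
  rewrite !big_split/= /d/=.
  have mxe (s : 'S_N) : \prod_(i < N) (\matrix_(i < N, j < N) v i ^+ j) i (s i) =
      \prod_(i < N) v i ^+ s i by apply: eq_bigr => i _; rewrite mxE.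
  rewrite !mxe.
  move: (\prod_(i < N) v i ^+ s1 i) (\prod_(i < N) v i ^+ s2 i) (\prod_(i < N) v i ^+ e t i).
  move: (\prod_(i < N) v i `^ _) (\prod_(i < N) (1 - v i) `^ _) ((-1) ^+ s1) ((-1) ^+ s2).
  by move: (c t) => x1 x2 x3 x4 x5 x6 x7 x8; ring.
rewrite iint_sum_prod//.
rewrite -(pair_bigA _ (fun t p => d (t, p) *
  \prod_(i < N) \int[mu]_(x in `[0, 1]) h (t, p) i x))/=.
apply: eq_bigr => t _.
rewrite -(pair_bigA _ (fun s1 s2 => d (t, (s1, s2)) *
  \prod_(i < N) \int[mu]_(x in `[0, 1]) h (t, (s1, s2)) i x))/=.
rewrite /alternating_sum mulr_sumr; apply: eq_bigr => s1 _.
rewrite /determinant !mulr_sumr; apply: eq_bigr => s2 _.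
rewrite /d/= -!mulrA; congr (_ * (_ * (_ * _))); apply: eq_bigr => i _.
rewrite hE mxE /beta_moment /beta_integral/=; apply: eq_Rintegral => x.
by rewrite inE/= in_itv/= => /andP[x0 _]; rewrite beta_kernelX.
Qed.

End jacobi_determinant.

(** * Bounds and closed formula for I_k *)

Section jacobi_moments.
Context {R : realType}.
Variables (a b : R) (N : nat).
Hypotheses (a0 : 0 < a) (b0 : 0 < b) (N0 : (0 < N)%N).

Local Notation m := (beta_moment a b).

Lemma beta_moment_gt0 n : 0 < beta_moment a b n.
Proof. by apply: beta_integral_gt0 => //; rewrite ltr_wpDr. Qed.

Lemma beta_moment_rec n :
  (a + b + n%:R) * beta_moment a b n.+1 = (a + n%:R) * beta_moment a b n.
Proof.
rewrite /beta_moment -natr1 addrA -beta_integral_recl ?ltr_wpDr//.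
by rewrite [a + b + _]addrAC.
Qed.

Lemma iint_jacobi_weight :
  iint N (jacobi_weight N a b) = N`!%:R * hankel_det m N.
Proof.
have := iint_monomials a0 b0 (fun _ : unit => 1) (fun _ (_ : 'I_N) => 0%N).
rewrite big_const card_unit/= addr0 mul1r alternating_sum0 => <-.
congr iint; apply/funext => v.
by rewrite big_const card_unit/= addr0 mul1r big1 ?mul1r.
Qed.

Lemma iint_power_sum k :
  iint N (fun v => power_sum N k v * jacobi_weight N a b v) =
  N`!%:R * hankel_sum m N k.
Proof.
have := iint_monomials a0 b0 (fun _ : 'I_N => 1) (fun r i => (i == r) * k)%N.
under [X in _ = X -> _]eq_bigr do rewrite mul1r.
rewrite sum_alternating_sum => <-.
congr iint; apply/funext => v; congr (_ * _); rewrite /power_sum big_mkord.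
apply: eq_bigr => r _; rewrite mul1r (bigD1 r)//= eqxx mul1n big1 ?mulr1//.
by move=> i /negPf ->.
Qed.

(** The integrand is nonnegative on the cube, which will give I_k <= N. The monomials are indexed by
    pairs: (true, r) stands for - x_r^k and (false, r) for 1. *)
Lemma iint_power_sum_compl k :
  iint N (fun v => (N%:R - power_sum N k v) * jacobi_weight N a b v) =
  N`!%:R * (N%:R * hankel_det m N - hankel_sum m N k).
Proof.
have sumE (f : bool * 'I_N -> R) (G H : 'I_N -> R) :
    (forall r, f (true, r) = - G r) -> (forall r, f (false, r) = H r) ->
    \sum_p f p = \sum_r H r - \sum_r G r.
  move=> fG fH; rewrite (eq_bigr (fun p => f (p.1, p.2))); last by case.
  rewrite -(pair_bigA _ (fun x r => f (x, r)))/= big_bool/= addrC -sumrN.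
  by congr (_ + _); apply: eq_bigr => r _.
have := iint_monomials a0 b0 (fun p : bool * 'I_N => if p.1 then -1 else 1)
  (fun p => if p.1 then fun i => ((i == p.2) * k)%N else fun=> 0%N).
rewrite (sumE _ (fun r => alternating_sum m (fun i => (i == r) * k)%N)
  (fun=> alternating_sum m (fun _ : 'I_N => 0%N))); [|by move=> r; rewrite mulN1r|
  by move=> r; rewrite mul1r].
rewrite [X in _ = X - _ -> _]sumr_const card_ord alternating_sum0.
rewrite sum_alternating_sum -mulrnAr -mulrBr -[hankel_det m N *+ N]mulr_natl => <-.
congr iint; apply/funext => v; congr (_ * _).
rewrite (sumE _ (fun r => \prod_(i < N) v i ^+ ((i == r) * k)) (fun=> 1)); last 2 first.
- by move=> r; rewrite mulN1r.
- by move=> r; rewrite mul1r big1.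
rewrite sumr_const card_ord /power_sum big_mkord; congr (_ - _).
apply: eq_bigr => r _.
by rewrite (bigD1 r)//= eqxx mul1n big1 ?mulr1// => i /negPf ->.
Qed.

Lemma jacobi_weight_ge0 v : 0 <= jacobi_weight N a b v.
Proof.
rewrite jacobi_weightE mulr_ge0 ?sqr_ge0// prodr_ge0// => i _.
exact: beta_kernel_ge0.
Qed.

(** Nonvanishing is algebraic, by [hankel_det_neq0]; the sign is that of the integral of the
    nonnegative weight. *)
Lemma det_moments_gt0 : 0 < hankel_det m N.
Proof.
rewrite lt_neqAle eq_sym (hankel_det_neq0 a0 b0 _ beta_moment_rec N0)/=.
  rewrite -(pmulr_rge0 _ (_ : 0 < N`!%:R)) ?ltr0n ?fact_gt0//.
  rewrite -iint_jacobi_weight; apply: iint_ge0 => v _; exact: jacobi_weight_ge0.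
by move=> n; rewrite gt_eqF// beta_moment_gt0.
Qed.

Lemma Ik_det k : Ik N k a b = hankel_sum m N k / hankel_det m N.
Proof.
rewrite /Ik /jacobi_avg iint_power_sum.
under [X in _ / (_ * iint _ X)]eq_fun do rewrite mul1r.
have n0 : N`!%:R != 0 :> R by rewrite pnatr_eq0 -lt0n fact_gt0.
by rewrite iint_jacobi_weight !mulKf.
Qed.

Lemma Ik_ge0_le k : 0 <= Ik N k a b <= N%:R.
Proof.
have fN : 0 < N`!%:R :> R by rewrite ltr0n fact_gt0.
have D0 := det_moments_gt0.
rewrite Ik_det; apply/andP; split.
  apply: divr_ge0 (ltW D0); rewrite -(pmulr_rge0 _ fN) -iint_power_sum; apply: iint_ge0 => v v01.
  rewrite mulr_ge0 ?jacobi_weight_ge0// /power_sum big_mkord sumr_ge0// => i _.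
  by rewrite exprn_ge0//; case/andP: (v01 i (ltn_ord i)).
rewrite ler_pdivrMr// -subr_ge0 -(pmulr_rge0 _ fN) -iint_power_sum_compl.
apply: iint_ge0 => v v01; rewrite mulr_ge0 ?jacobi_weight_ge0// subr_ge0.
rewrite /power_sum big_mkord -[N in leRHS]card_ord -sumr_const.
by apply: ler_sum => i _; have /andP[? ?] := v01 i (ltn_ord i); rewrite exprn_ile1.
Qed.

Lemma Ik_formula k : (0 < k <= N)%N ->
  Ik N k a b = \sum_(s < k)
    \prod_(0 <= u < s) ((u%:R - s%:R + k%:R) / (u%:R - s%:R)) *
    \prod_(0 <= t < k) ((t%:R + N%:R - s%:R) / (t%:R + 1)) *
    \prod_(0 <= t < k) ((a + (N%:R - 1 - s%:R + t%:R)) /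
                        (a + b + (2 * (N%:R - 1) - s%:R + t%:R))).
Proof.
move=> kN; rewrite Ik_det; apply: hankel_ratio => // n; last exact: beta_moment_rec.
by rewrite gt_eqF// beta_moment_gt0.
Qed.

End jacobi_moments.

(** * Rationality in N and the limit *)

Unset Implicit Arguments.

Theorem theorem1 (R : realType) (a0 a1 b0 b1 : R)
  (ha : forall N : nat, (0 < N)%N -> 0 < a1 * N%:R + a0)
  (hb : forall N : nat, (0 < N)%N -> 0 < b1 * N%:R + b0)
  (k : nat) (hk : (1 <= k)%N) :
  exists l : R,
    (fun N : nat => Ik N k (a1 * N%:R + a0) (b1 * N%:R + b0) / N%:R) @ \oo --> l.
Proof.
(* The bound 1 comes from 0 <= I_k <= N. *)
apply: (@cvg_bounded_rational _ _ 1); last first.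
  near=> N.
  have N0 : (0 < N)%N by near: N; exact: nbhs_infty_gt.
  have /andP[I0 IN] := Ik_ge0_le (ha N N0) (hb N N0) N0 k.
  have N0R : 0 < N%:R :> R by rewrite ltr0n.
  by rewrite /= ger0_norm ?(divr_ge0 I0 (ltW N0R))// ler_pdivrMr ?mul1r.
apply: rationalM; last first.
  apply: rationalV; last exact: rational_natr.
  by near=> N; rewrite pnatr_eq0 -lt0n; near: N; exact: nbhs_infty_gt.
have ratN := @rational_natr R.
have ratc (c : R) := rational_cst c.
have rata : eventually_rational (fun N => a1 * N%:R + a0).
  by apply: rationalD => //; exact: rationalM.
have ratb : eventually_rational (fun N => b1 * N%:R + b0).
  by apply: rationalD => //; exact: rationalM.
have rat1 (s : nat) : eventually_rational (fun N => N%:R - 1 - s%:R : R).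
  by apply: rationalD => //; exact: rationalD.
have rat2 (s : nat) : eventually_rational (fun N => 2 * (N%:R - 1) - s%:R : R).
  by apply: rationalD => //; apply: rationalM => //; exact: rationalD.
apply: near_eq_rational (_ : eventually_rational (fun N => \sum_(s < k)
    \prod_(0 <= u < s) ((u%:R - s%:R + k%:R) / (u%:R - s%:R)) *
    \prod_(0 <= t < k) ((t%:R + N%:R - s%:R) / (t%:R + 1)) *
    \prod_(0 <= t < k) ((a1 * N%:R + a0 + (N%:R - 1 - s%:R + t%:R)) /
      (a1 * N%:R + a0 + (b1 * N%:R + b0) + (2 * (N%:R - 1) - s%:R + t%:R))))).
  near=> N.
  have kN : (k <= N)%N by near: N; exact: nbhs_infty_ge.
  have N0 : (0 < N)%N by exact: leq_trans kN.
  by rewrite (Ik_formula (ha N N0) (hb N N0) N0)// hk.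
apply: rational_sum => s; apply: rationalM.
  apply: rationalM; first exact: ratc.
  apply: rational_prod => t; apply: rationalM; last exact: ratc.
  by apply: rationalD; [exact: rationalD|exact: ratc].
apply: rational_prod => t; apply: rationalM.
  by apply: rationalD => //; exact: rationalD.
apply: rationalV; last by apply: rationalD; [exact: rationalD|exact: rationalD].
near=> N.
have N0 : (0 < N)%N by near: N; exact: nbhs_infty_gt.
(* From s <= N - 1 follows 2 (N - 1) - s >= N - 1 >= 0, so the denominator is at least a(N) + b(N) >
   0. *)
have sN : (s < N)%N by near: N; exact: nbhs_infty_gt.
have N1 : 1 <= N%:R :> R by rewrite ler1n.
have sN1 : s%:R + 1 <= N%:R :> R by rewrite natr1 ler_nat.
have t0 : 0 <= t%:R :> R by [].
have := ha N N0; have := hb N N0; move=> hb0 ha0.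
by rewrite gt_eqF//; lra.
Unshelve. all: by end_near. Qed.
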